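(* Fix any $\epsilon>0$ and a positive integer $\rho$. There is a deterministic algorithm which, given positive integers $r_1,\ldots,r_m\le\rho$ and positive integers $c_1,\ldots,c_n$ with $r_1+\cdots+r_m=c_1+\cdots+c_n=N$, approximates the number of $m\times n$ contingency tables with row sums $r_1,\ldots,r_m$ and column sums $c_1,\ldots,c_n$ within a factor of $(1-\epsilon)^N$. The algorithm has quasi-polynomial complexity $m^{O(\log n)}$.
   Context: An $m\times n$ contingency table with row sums $r_1,\ldots,r_m$ and column sums $c_1,\ldots,c_n$ is an $m\times n$ matrix with non-negative integer entries having these row and column sums. The numbers $\epsilon$ and $\rho$ are fixed in advance. The row sums are bounded by the constant $\rho$; the column sums are allowed to be large (they are not assumed bounded by a constant). *)

(* Defs.v *)
From HB Require Import structures.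
From mathcomp Require Import all_boot all_order all_algebra.
From mathcomp Require Import reals exp.

Set Implicit Arguments.
Unset Strict Implicit.
Unset Printing Implicit Defensive.

Import Order.TTheory GRing.Theory Num.Theory.

(** * Contingency tables *)

Definition contingency_table m n (r : m.-tuple nat) (c : n.-tuple nat)
    (A : 'M[nat]_(m, n)) : bool :=
  [forall i, (\sum_j A i j == tnth r i)%N] &&
  [forall j, (\sum_i A i j == tnth c j)%N].

(* The entries of a contingency table are at most the sum of all the row sums, *)
(* so letting them range over the finite type 'I_N.+1 with N that sum loses    *)
(* nothing; see [contingency_table_bounded].                                   *)
Definition num_tables m n (r : m.-tuple nat) (c : n.-tuple nat) : nat :=
  #|[set A : 'M['I_(\sum_i tnth r i).+1]_(m, n) |
       contingency_table r c (map_mx (@nat_of_ord _) A)]|.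

Lemma contingency_table_bounded m n (r : m.-tuple nat) (c : n.-tuple nat)
    (A : 'M[nat]_(m, n)) :
  contingency_table r c A ->
  exists B : 'M['I_(\sum_i tnth r i).+1]_(m, n), A = map_mx (@nat_of_ord _) B.
Proof.
case/andP=> /forallP rA _.
exists (\matrix_(i, j) inord (A i j))%R; apply/matrixP=> i j.
rewrite !mxE inordK // ltnS (bigD1 i) //= -(eqP (rA i)) (bigD1 j) //=.
by rewrite -addnA leq_addr.
Qed.

(** * The model of computation *)

(* A structured random access machine with logarithmic cost.  The store is a   *)
(* family of arrays of natural numbers; a program names the arrays it uses by  *)
(* constants, and the scalar variable [x] is the cell [x, 0].  Every access is *)
(* charged the bit length of the index and of the value, and every arithmetic  *)
(* operation the product of the bit lengths of its operands, as in schoolbook  *)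
(* multiplication and division; hence the cost is polynomially related to the  *)
(* running time of a Turing machine.                                           *)

Definition store := nat -> nat -> nat.

Definition update (s : store) (a i v : nat) : store :=
  fun b j => if (b == a) && (j == i) then v else s b j.

Inductive binop := Add | Sub | Mul | Div | Mod | Leq.

Definition eval_binop (o : binop) (x y : nat) : nat :=
  match o with
  | Add => x + y
  | Sub => x - y
  | Mul => x * y
  | Div => x %/ y
  | Mod => x %% y
  | Leq => (x <= y)%N
  end.

Inductive expr :=
  | Const of nat
  | Cell of nat & expr
  | Binop of binop & expr & expr.

Fixpoint eval (e : expr) (s : store) : nat :=
  match e with
  | Const k => k
  | Cell a e1 => s a (eval e1 s)
  | Binop o e1 e2 => eval_binop o (eval e1 s) (eval e2 s)
  end.

(* The length of the binary expansion of [x], with [bitlen 0 = 1]. *)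
Definition bitlen (x : nat) : nat := (trunc_log 2 x).+1.

Fixpoint eval_cost (e : expr) (s : store) : nat :=
  match e with
  | Const k => bitlen k
  | Cell a e1 => eval_cost e1 s + (bitlen (eval e1 s) + bitlen (eval e s))
  | Binop o e1 e2 =>
      eval_cost e1 s + eval_cost e2 s + bitlen (eval e1 s) * bitlen (eval e2 s)
  end.

Inductive cmd :=
  | Skip
  | Assign of nat & expr & expr
  | Seq of cmd & cmd
  | If of expr & cmd & cmd
  | While of expr & cmd.

(* [exec p s t s'] : started in [s], the program [p] halts in [s'] at cost [t]. *)
Inductive exec : cmd -> store -> nat -> store -> Prop :=
  | ExecSkip s : exec Skip s 1 s
  | ExecAssign a e1 e2 s :
      exec (Assign a e1 e2) s
        (eval_cost e1 s + eval_cost e2 s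
         + (bitlen (eval e1 s) + bitlen (eval e2 s)))
        (update s a (eval e1 s) (eval e2 s))
  | ExecSeq p q s t s' t' s'' :
      exec p s t s' -> exec q s' t' s'' -> exec (Seq p q) s (t + t').+1 s''
  | ExecIfTrue e p q s t s' :
      eval e s != 0 -> exec p s t s' ->
      exec (If e p q) s (eval_cost e s + t).+1 s'
  | ExecIfFalse e p q s t s' :
      eval e s = 0 -> exec q s t s' ->
      exec (If e p q) s (eval_cost e s + t).+1 s'
  | ExecWhileTrue e p s t s' t' s'' :
      eval e s != 0 -> exec p s t s' -> exec (While e p) s' t' s'' ->
      exec (While e p) s (eval_cost e s + t + t').+1 s''
  | ExecWhileFalse e p s :
      eval e s = 0 -> exec (While e p) s (eval_cost e s).+1 s.

Lemma exec_deterministic p s t1 s1 t2 s2 :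
  exec p s t1 s1 -> exec p s t2 s2 -> t1 = t2 /\ s1 = s2.
Proof.
move=> H; elim: H t2 s2 => {p s t1 s1} [||||||] *;
  match goal with H : exec _ _ _ _ |- _ =>
    inversion H; subst; clear H end;
  repeat match goal with
  | N : is_true (eval ?e ?s != 0), Z : eval ?e ?s = 0 |- _ =>
      by rewrite Z in N
  | IH : forall t s, exec ?p ?s0 t s -> _, H : exec ?p ?s0 _ _ |- _ =>
      case: (IH _ _ H) => ? ?; subst; clear H
  end; by [].
Qed.

(* Arrays 0 and 1 hold the dimensions in their cell 0, arrays 2 and 3 the row  *)
(* sums and the column sums; all the other cells are 0.                        *)
Definition input m n (r : m.-tuple nat) (c : n.-tuple nat) : store :=
  fun a i => match a with
             | 0 => if i == 0 then m else 0
             | 1 => if i == 0 then n else 0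
             | 2 => nth 0 r i
             | 3 => nth 0 c i
             | _ => 0
             end.

(* The output is the rational number (cell 0 of array 0) / (cell 0 of array 1). *)
Definition output (R : realType) (s : store) : R :=
  ((s 0%N 0%N)%:R / (s 1%N 0%N)%:R)%R.

(** * Approximation and complexity *)

(* [a] approximates [x >= 0] within a factor of [f], where [0 < f <= 1]. *)
Definition approx_within (R : realType) (f x a : R) : Prop :=
  (f * x <= a <= x)%R.

(* The bound m^(O(log n)), with [K] the constant of the O.  The shifts by one  *)
(* only matter for m = 1 or n = 1, where m ^ (K log n) = 1 would not leave     *)
(* time to read the input: if m, n >= 2, the bound is at most m ^ (4 K ln n)   *)
(* for K >= 0.                                                                 *)
Definition quasi_poly_bound (R : realType) (K : R) (m n : nat) : R :=
  (m.+1%:R `^ (K * ln n.+1%:R))%R.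

(* Main.v *)
Require Import Defs.
From HB Require Import structures.
From mathcomp Require Import all_boot all_order all_algebra.
From mathcomp Require Import boolp reals exp.
From mathcomp Require Import zify.

Set Implicit Arguments.
Unset Strict Implicit.
Unset Printing Implicit Defensive.

Import Order.TTheory GRing.Theory Num.Theory.

(* Since the row sums are bounded by the constant rho, the tables can even be   *)
(* counted exactly in time polynomial in m.  Fill the columns one after         *)
(* another and, inside a column, one row after another.  The number of          *)
(* completions depends only on how many rows with each residual sum k <= rho    *)
(* are still to be treated in the current column, how many with each residual   *)
(* sum are already treated, and how many columns are left, because a column     *)
(* has the right sum iff the residual row sums then add up to the remaining     *)
(* column sums.  There are (n + 1) (m + 1)^(2 rho + 2) states, and n <= rho m.  *)

(** An exact count meets the approximation requirement, because [(1 - eps) ^+ N] is at most 1; so it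
    suffices to count exactly within the time bound. The number of completions of a partly filled
    table is symmetric in the residual row sums ([count_tables_perm], [split_column_perm]), so a
    state can be recorded by multiplicities, that is, by the digits of a number in base [m + 1]
    ([code_digit]). The recursion only leads to smaller state indices ([dp_step_causal]), so one
    loop over the indices computes it ([dpE]); [num_tablesE] ties it to contingency tables. The
    entry at index [x] is at most [(rho + 1) ^ x] ([dp_le]), so all stored numbers have polynomially
    many bits, and the logarithmic cost is at most a constant times the cube of the number of states
    ([exec_prog]). Positive column sums give [n <= N <= rho * m], so the cost is at most
    [(m + 1) ^ d] with [d] depending on [rho] only. As [ln (n + 1) >= ln 2], the constant
    [K = d / ln 2] makes this an instance of the quasi-polynomial bound. *)

Fixpoint weight (e : expr) : nat :=
  match e with
  | Const k => k.+1
  | Cell _ e1 => (weight e1).+1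
  | Binop _ e1 e2 => weight e1 + weight e2
  end.

Definition bounded (V : nat) (s : store) := forall a i, s a i <= V.

Lemma weight_gt0 e : 0 < weight e.
Proof. by elim: e => //= _ e1 ? e2 ?; lia. Qed.

Lemma bitlen_le x L : 0 < L -> x < 2 ^ L -> bitlen x <= L.
Proof.
move=> L0; rewrite /bitlen; case: x => [|x xL]; first by rewrite trunc_log0.
by rewrite -(ltn_exp2l _ _ (isT : 1 < 2)); apply: leq_ltn_trans xL; apply: trunc_logP.
Qed.

(** Weights are positive, so both operand bounds are at least 2 and their sum is at most their
    product; hence adding exponents covers every operation. *)
Lemma eval_le V s e : 1 < V -> bounded V s -> eval e s <= V ^ weight e.
Proof.
move=> V1 bV; elim: e => [k|a e1 _|o e1 IH1 e2 IH2] /=.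
- by apply: ltnW; apply: leq_trans (ltn_expl _ V1) _; rewrite leq_exp2l.
- by apply: leq_trans (bV _ _) _; rewrite expnS leq_pmulr // expn_gt0; lia.
have ge2 e : 2 <= V ^ weight e.
  by apply: leq_trans (V1) _; rewrite -[X in X <= _]expn1 leq_exp2l // weight_gt0.
rewrite expnD; move: IH1 IH2 (ge2 e1) (ge2 e2).
move: (eval e1 s) (eval e2 s) (V ^ weight e1) (V ^ weight e2) => x y p q xp yq p2 q2.
have pq : p + q <= p * q by nia.
have x_le : x <= p * q by lia.
case: o => /=; first by lia.
- by lia.
- exact: leq_mul.
- exact: leq_trans (leq_div x y) x_le.
- exact: leq_trans (leq_mod x y) x_le.
- by case: (x <= y); lia.
Qed.

Lemma bitlen_eval W s e :
  0 < W -> bounded (2 ^ W) s -> bitlen (eval e s) <= weight e * W.+1.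
Proof.
move=> W0 bW; apply: bitlen_le; first by rewrite muln_gt0 weight_gt0.
apply: leq_ltn_trans (eval_le e _ bW) _; first by rewrite -[1](expn0 2) ltn_exp2l.
by rewrite -expnM ltn_exp2l //; have := weight_gt0 e; nia.
Qed.

(** The square of the weight works because its cross term absorbs the product of bit lengths charged
    at each operation. *)
Lemma eval_cost_le W s e :
  0 < W -> bounded (2 ^ W) s -> eval_cost e s <= 2 * weight e ^ 2 * W.+1 ^ 2.
Proof.
move=> W0 bW; elim: e => [k|a e1 IH1|o e1 IH1 e2 IH2].
- by apply: leq_trans (bitlen_eval (Const k) W0 bW) _; rewrite /= -!mulnn; nia.
- have b1 := bitlen_eval e1 W0 bW; have b2 : bitlen (s a (eval e1 s)) <= W.+1.
    by apply: bitlen_le => //; apply: leq_ltn_trans (bW _ _) _; rewrite ltn_exp2l.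
  by rewrite /=; rewrite -!mulnn in IH1 *; nia.
have b1 := bitlen_eval e1 W0 bW; have b2 := bitlen_eval e2 W0 bW.
have := leq_mul b1 b2; rewrite /=; rewrite -!mulnn in IH1 IH2 *; nia.
Qed.

Lemma exec_assign W s a e1 e2 s' : 0 < W -> bounded (2 ^ W) s ->
  s' = update s a (eval e1 s) (eval e2 s) ->
  exists2 t, exec (Assign a e1 e2) s t s'
           & t <= 3 * (weight e1 + weight e2) ^ 2 * W.+1 ^ 2.
Proof.
move=> W0 bW ->; eexists; first exact: ExecAssign.
have := eval_cost_le e1 W0 bW; have := eval_cost_le e2 W0 bW.
have := bitlen_eval e1 W0 bW; have := bitlen_eval e2 W0 bW.
have := weight_gt0 e1; have := weight_gt0 e2.
rewrite -!mulnn; nia.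
Qed.

Definition var (a : nat) := Cell a (Const 0).

(* The counter is the cell [k, 0]; the loop does [a[i] := e] for [i < u]. *)
Definition tabulate (k a : nat) (u e : expr) : cmd :=
  While (Binop Leq (Binop Add (var k) (Const 1)) u)
    (Seq (Assign a (var k) e)
         (Assign k (Const 0) (Binop Add (var k) (Const 1)))).

Definition tabulated (s : store) (k a : nat) (g : nat -> nat) (i : nat) : store :=
  fun b j => if (b == k) && (j == 0) then i
             else if (b == a) && (j < i) then g j else s b j.

Lemma tabulated0 s k a g : s k 0 = 0 -> tabulated s k a g 0 = s.
Proof.
move=> sk; apply/funext => b; apply/funext => j; rewrite /tabulated ltn0 andbF.
by case: andP => // -[/eqP-> /eqP->].
Qed.

Lemma tabulatedS s (k a : nat) g i : k != a ->
  update (update (tabulated s k a g i) a i (g i)) k 0 i.+1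
  = tabulated s k a g i.+1.
Proof.
move=> ka; apply/funext => b; apply/funext => j; rewrite /update /tabulated.
have [->|bk] := eqVneq b k; first by rewrite (negPf ka); case: eqP.
rewrite /=; have [->|//] := eqVneq b a; rewrite /= ltnS.
by case: ltngtP => // ->.
Qed.

Lemma bounded_tabulated V s k a g i : bounded V s -> i <= V ->
  (forall j, j < i -> g j <= V) -> bounded V (tabulated s k a g i).
Proof.
move=> bV iV gV b j; rewrite /tabulated; case: ifP => // _.
by case: ifP => // /andP[_ /gV].
Qed.

Definition tabulate_cost (u e : expr) : nat := 10 * (weight u + weight e + 10) ^ 2.

(** Induction on the number of rounds still to run, with [tabulated] as loop invariant. In round [i]
    the expression [e] is evaluated in the partly filled store, so it may read the cells of [a]
    below [i]; this is what lets the loop run a recursion. *)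
Lemma exec_tabulate W s (k a : nat) u e g U :
  0 < W -> k != a -> s k 0 = 0 ->
  bounded (2 ^ W) s -> U <= 2 ^ W -> (forall i, i < U -> g i <= 2 ^ W) ->
  (forall i, i <= U -> eval u (tabulated s k a g i) = U) ->
  (forall i, i < U -> eval e (tabulated s k a g i) = g i) ->
  exists2 t, exec (tabulate k a u e) s t (tabulated s k a g U)
           & t <= tabulate_cost u e * W.+1 ^ 2 * U.+1.
Proof.
move=> W0 ka sk bs UW gW uU eg.
suff: forall d i, d + i = U ->
    exists2 t, exec (tabulate k a u e) (tabulated s k a g i) t
                    (tabulated s k a g U)
             & t <= tabulate_cost u e * W.+1 ^ 2 * d.+1.
  by move=> /(_ U 0 (addn0 _)); rewrite tabulated0.
have kE i : tabulated s k a g i k 0 = i by rewrite /tabulated !eqxx.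
have bi i : i <= U -> bounded (2 ^ W) (tabulated s k a g i).
  move=> iU; apply: bounded_tabulated => // [|j ji]; first exact: leq_trans UW.
  by apply: gW; apply: leq_trans iU.
pose guard := Binop Leq (Binop Add (var k) (Const 1)) u.
have gE i : i <= U -> eval guard (tabulated s k a g i) = (i < U).
  by move=> iU; rewrite /= kE uU // addn1.
have gc i : i <= U -> eval_cost guard (tabulated s k a g i) + 2
    <= 3 * (weight u + weight e + 10) ^ 2 * W.+1 ^ 2.
  move=> iU; apply: leq_trans (leq_add (eval_cost_le guard W0 (bi i iU)) (leqnn 2)) _.
  have L0 : 0 < W.+1 ^ 2 by rewrite expn_gt0.
  have c_le : 2 * weight guard ^ 2 + 2 <= 3 * (weight u + weight e + 10) ^ 2.
    by rewrite /= -!mulnn; nia.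
  apply: leq_trans (leq_mul c_le (leqnn _)).
  by rewrite mulnDl leq_add2l; nia.
elim=> [|d IHd] i dU.
  rewrite add0n in dU; subst i; eexists; first by apply: ExecWhileFalse; rewrite gE // ltnn.
  by have := gc U (leqnn U); rewrite /tabulate_cost /guard -!mulnn; nia.
have iU : i < U by lia.
have [t et tle] := IHd i.+1 ltac:(lia).
set s0 := tabulated s k a g i in et *.
set s1 := update s0 a i (g i).
have b1 : bounded (2 ^ W) s1.
  move=> b j; rewrite /s1 /update; case: ifP => [_|_]; first exact: gW.
  exact: (bi i (ltnW iU)).
have s1k : s1 k 0 = i by rewrite /s1 /update (negPf ka) /= /s0 kE.
have sE : eval (var k) s0 = i by rewrite /= /s0 kE.
have [|t1 x1 t1le] := exec_assign (s' := s1) (a := a) (e1 := var k) (e2 := e) W0 (bi i (ltnW iU)).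
  by rewrite sE eg.
have [|t2 x2 t2le] := exec_assign (s' := tabulated s k a g i.+1)
    (a := k) (e1 := Const 0) (e2 := Binop Add (var k) (Const 1)) W0 b1.
  by rewrite -tabulatedS //= s1k addn1.
eexists.
  apply: ExecWhileTrue et; last exact: ExecSeq x1 x2.
  by rewrite -/guard (gE i (ltnW iU)) iU.
have := gc i (ltnW iU); rewrite -/guard -/s0.
have : 0 < W.+1 ^ 2 by rewrite expn_gt0.
move: tle t1le t2le; rewrite /tabulate_cost /= -!(mulnn (_ + _)).
move: (weight u) (weight e) (W.+1 ^ 2) (eval_cost _ _) (weight_gt0 u) (weight_gt0 e).
nia.
Qed.

(** * Counting tables column by column through residual row sums *)

(* [s] lists the residual sums of the rows not yet treated in the current       *)
(* column, [t] those of the treated ones; [F] counts the ways to fill the       *)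
(* remaining columns.                                                           *)
Fixpoint split_column (F : seq nat -> nat) (s t : seq nat) : nat :=
  match s with
  | [::] => F t
  | k :: s' => \sum_(l < k.+1) split_column F s' (rcons t l)
  end.

(* The sum of the first column of [c] is enforced only indirectly, by comparing *)
(* the total of [s] with that of [c] before and after filling this column.      *)
Fixpoint count_tables (c s : seq nat) : nat :=
  match c with
  | [::] => sumn s == 0
  | _ :: c' => (sumn s == sumn c) * split_column (count_tables c') s [::]
  end.

Definition perm_invariant (F : seq nat -> nat) :=
  forall s t, perm_eq s t -> F s = F t.

Lemma split_column_permr F s t1 t2 : perm_invariant F ->
  perm_eq t1 t2 -> split_column F s t1 = split_column F s t2.
Proof.
move=> pF; elim: s t1 t2 => [|k s IHs] t1 t2 pt /=; first exact: pF.
by apply: eq_bigr => l _; apply: IHs; rewrite -!cats1 perm_cat2r.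
Qed.

(** Any untreated row may be treated next: exchanging two sums only permutes the treated list, to
    which [F] is insensitive. *)
Lemma split_column_mid F s1 k s2 t : perm_invariant F ->
  split_column F (s1 ++ k :: s2) t
  = \sum_(l < k.+1) split_column F (s1 ++ s2) (rcons t l).
Proof.
move=> pF; elim: s1 t => [|j s1 IHs] t //=.
under eq_bigr do rewrite IHs.
rewrite exchange_big /=; apply: eq_bigr => l _; apply: eq_bigr => i _.
apply: split_column_permr => //.
by rewrite -!cats1 -!catA perm_cat2l perm_catC.
Qed.

Lemma split_column_perm F s1 s2 t1 t2 : perm_invariant F ->
  perm_eq s1 s2 -> perm_eq t1 t2 -> split_column F s1 t1 = split_column F s2 t2.
Proof.
move=> pF; elim: s1 s2 t1 t2 => [|k s1 IHs] s2 t1 t2 ps pt.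
  by move: ps; rewrite perm_sym => /perm_nilP->; apply: split_column_permr.
have ks2 : k \in s2 by rewrite -(perm_mem ps) mem_head.
case/splitPr: ks2 ps => p1 p2 ps.
rewrite split_column_mid //=; apply: eq_bigr => l _; apply: IHs.
  by move: ps; rewrite perm_sym perm_catC /= perm_cons perm_catC perm_sym.
by rewrite -!cats1 perm_cat2r.
Qed.

Lemma count_tables_perm c : perm_invariant (count_tables c).
Proof.
elim: c => [|c0 c IHc] s t st /=; rewrite (perm_sumn st) //.
by rewrite (split_column_perm IHc st (perm_refl _)).
Qed.

Lemma count_tables_sumn c s : count_tables c s != 0 -> sumn s = sumn c.
Proof. by case: c => [|c0 c] /=; case: (sumn s =P _). Qed.

Lemma sum_tuple_cons (T : finType) n (G : n.+1.-tuple T -> nat) :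
  \sum_(t : n.+1.-tuple T) G t
  = \sum_(x : T) \sum_(t : n.-tuple T) G [tuple of x :: t].
Proof.
rewrite pair_big /=.
rewrite (reindex (fun p : T * n.-tuple T => [tuple of p.1 :: p.2])) //=.
exists (fun t => (thead t, [tuple of behead t])) => [[x t] _|t _] /=.
  by congr pair; apply/val_inj.
by case/tupleP: t => x t; apply/val_inj.
Qed.

Lemma sum_tuple0 (T : finType) (G : 0.-tuple T -> nat) :
  \sum_(t : 0.-tuple T) G t = G [tuple].
Proof.
rewrite (bigD1 [tuple]) //= big1 ?addn0 // => t /eqP[].
exact: tuple0.
Qed.

Definition subs (r x : seq nat) : seq nat := [seq a.1 - a.2 | a <- zip r x].

Lemma sum_residue B k (G : nat -> nat) : k <= B ->
  \sum_(x < B.+1) (x <= k) * G (k - x) = \sum_(l < k.+1) G l.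
Proof.
move=> kB; rewrite [RHS](reindex_inj rev_ord_inj) /=.
rewrite (big_ord_widen B.+1 (fun x => G (k.+1 - x.+1))) // [RHS]big_mkcond /=.
by apply: eq_bigr => x _; rewrite ltnS subSS; case: (x <= k); rewrite ?mul1n.
Qed.

(** [split_column] sums over what is left of a row rather than over its entry; the two are exchanged
    by [l = k - x] in each row. *)
Lemma sum_columns B m F (r p : seq nat) : size r = m -> all (leq^~ B) r ->
  \sum_(x : m.-tuple 'I_B.+1) all2 leq (map val x) r * F (p ++ subs r (map val x))
  = split_column F r p.
Proof.
elim: m r p => [|m IHm] [|k r] p //=.
  by move=> _ _; rewrite sum_tuple0 /= mul1n cats0.
move=> [sr] /andP[kB rB]; rewrite sum_tuple_cons /=.
rewrite -(sum_residue (fun l => split_column F r (rcons p l)) kB).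
apply: eq_bigr => x _; rewrite -IHm // big_distrr /=; apply: eq_bigr => t _.
by rewrite -mulnb -mulnA cat_rcons.
Qed.

(* [t] lists the columns of the table. *)
Fixpoint fits (r c : seq nat) (t : seq (seq nat)) : bool :=
  match c, t with
  | [::], [::] => sumn r == 0
  | c0 :: c', x :: t' => [&& all2 leq x r, sumn x == c0 & fits (subs r x) c' t']
  | _, _ => false
  end.

Lemma size_subs r x : size x = size r -> size (subs r x) = size r.
Proof. by move=> xr; rewrite size_map size1_zip ?xr. Qed.

Lemma nth_subs r x i : size x = size r ->
  nth 0 (subs r x) i = nth 0 r i - nth 0 x i.
Proof.
by elim: r x i => [|b r IHr] [|a x] [|i] //= [sx]; apply: IHr.
Qed.

Lemma sumn_subs r x : all2 leq x r -> sumn r = sumn x + sumn (subs r x).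
Proof.
elim: x r => [|a x IHx] [|b r] //= /andP[ab xr].
by rewrite (IHx _ xr) -/(subs r x); lia.
Qed.

Lemma all_subs B r x : all (leq^~ B) r -> all (leq^~ B) (subs r x).
Proof.
elim: r x => [|b r IHr] [|a x] //= /andP[bB rB]; rewrite IHr // andbT; lia.
Qed.

Lemma sum_fits B m n (r c : seq nat) : size r = m -> size c = n ->
  all (leq^~ B) r ->
  \sum_(t : n.-tuple (m.-tuple 'I_B.+1))
    fits r c (map (map val) [seq tval x | x <- t]) = count_tables c r.
Proof.
elim: n r c => [|n IHn] r [|c0 c] //= sr; first by rewrite sum_tuple0.
move=> [sc] rB; rewrite sum_tuple_cons /=.
rewrite -(sum_columns _ _ sr rB) big_distrr /=; apply: eq_bigr => x _.
set y := map val x.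
have sy : size y = size r by rewrite size_map size_tuple.
have sB := all_subs y rB.
have -> : \sum_(t : n.-tuple (m.-tuple 'I_B.+1))
    [&& all2 leq y r, sumn y == c0
      & fits (subs r y) c (map (map val) [seq tval x | x <- t])]
    = all2 leq y r * (sumn y == c0) * count_tables c (subs r y).
  rewrite -IHn ?size_subs // big_distrr /=; apply: eq_bigr => t _.
  by rewrite -!mulnb mulnA.
have [yr|_] := boolP (all2 leq y r); last by rewrite /= !mul0n muln0.
rewrite /= !mul1n.
(* If the remaining columns can be filled, the residues add up to [sumn c]; then [sumn y == c0] is
   equivalent to [sumn r == c0 + sumn c], the test made by [count_tables]. *)
have [->|/count_tables_sumn sE] := eqVneq (count_tables c (subs r y)) 0.
  by rewrite !muln0.
by rewrite (sumn_subs yr) sE eqn_add2r.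
Qed.

Lemma all2_leqP m x r : size x = m -> size r = m ->
  all2 leq x r = [forall i : 'I_m, nth 0 x i <= nth 0 r i].
Proof.
elim: m x r => [|m IHm] [|a x] [|b r] //=.
  by move=> _ _; apply/esym/forallP => -[].
move=> [sx] [sr]; rewrite (IHm x r) //; apply/idP/idP.
  move=> /andP[ab /forallP H]; apply/forallP => -[[|i] //= im].
  exact: (H (Ordinal (im : i < m))).
move=> /forallP H; rewrite (H ord0); apply/forallP => i; exact: (H (lift ord0 i)).
Qed.

(** Residues reach zero exactly when the entries add up to the row sum; the [all2 leq] tests keep
    the truncated subtraction honest. *)
Lemma fitsE m r c t : size r = m -> all (fun x => size x == m) t ->
  fits r c t = [forall i : 'I_m, nth 0 r i == \sum_(x <- t) nth 0 x i]
               && (map sumn t == c).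
Proof.
elim: c r t => [|c0 c IHc] r [|x t] //= sr; rewrite ?andbF //.
- rewrite eqxx andbT => _; apply/idP/idP => [/eqP r0|/forallP H].
    apply/forallP => i; rewrite big_nil.
    have : nth 0 r i <= sumn r.
      rewrite sumnE (big_nth 0) sr.
      by rewrite (bigD1_seq (val i)) ?mem_index_iota ?iota_uniq //= leq_addr.
    by rewrite r0 leqn0.
  rewrite sumnE (big_nth 0) sr big_mkord big1 // => i _.
  by have := H i; rewrite big_nil => /eqP.
move=> /andP[/eqP sx st]; rewrite (all2_leqP sx sr) IHc ?size_subs ?sx //.
rewrite eqseq_cons [RHS]andbCA [in LHS]andbCA; congr (_ && _).
rewrite andbA; congr (_ && _); apply/andP/forallP => [[/forallP xr /forallP rE] i|H].
  by have := xr i; have /eqP := rE i; rewrite nth_subs ?sx // big_cons => <-; lia.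
split; apply/forallP => i; have := H i; rewrite big_cons => /eqP.
  by move=> ->; apply: leq_addr.
by rewrite nth_subs ?sx // => ->; rewrite addKn.
Qed.

Lemma num_tablesE m n (r : m.-tuple nat) (c : n.-tuple nat) :
  num_tables r c = count_tables c r.
Proof.
rewrite /num_tables; set B := \sum_i tnth r i.
have rB : all (leq^~ B) r.
  by apply/all_tnthP => i; rewrite /B (bigD1 i) //= leq_addr.
rewrite -(sum_fits (size_tuple r) (size_tuple c) rB) -sum1_card.
pose h (t : n.-tuple (m.-tuple 'I_B.+1)) := (\matrix_(i, j) tnth (tnth t j) i)%R.
rewrite big_mkcond /= (reindex h) /=; last first.
  exists (fun A => [tuple [tuple A i j | i < m] | j < n]) => [t _|A _].
    by apply/eq_from_tnth => j; apply/eq_from_tnth => i; rewrite !tnth_mktuple mxE.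
  by apply/matrixP => i j; rewrite mxE !tnth_mktuple.
apply: eq_bigr => t _; rewrite inE (@fitsE m) ?size_tuple //; last first.
  by rewrite !all_map; apply/allP => x _ /=; rewrite size_map size_tuple.
suff -> : contingency_table r c (map_mx (@nat_of_ord _) (h t))
  = [forall i : 'I_m, nth 0 r i
       == \sum_(x <- map (map val) [seq tval x | x <- t]) nth 0 x i]
    && (map sumn (map (map val) [seq tval x | x <- t]) == c).
  by case: (_ && _).
congr (_ && _).
  apply: eq_forallb => i; rewrite !big_map big_tuple eq_sym (tnth_nth 0).
  congr (_ == _); apply: eq_bigr => j _; rewrite !mxE.
  by rewrite (nth_map ord0) ?size_tuple // -tnth_nth.
have nthE j : nth 0 (map sumn (map (map val) [seq tval x | x <- t])) j
    = if insub j is Some j' then \sum_i (map_mx (@nat_of_ord _) (h t)) i j' else 0.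
  case: insubP => [j' jn j'E|]; last first.
    by rewrite -leqNgt => nj; rewrite nth_default // !size_map size_tuple.
  rewrite -!map_comp -j'E (nth_map (tnth t j')) ?size_tuple //=.
  rewrite -[nth _ _ _]/(nth (tnth t j') t (nat_of_ord j')) -tnth_nth.
  by rewrite sumnE big_map big_tuple; apply: eq_bigr => i _; rewrite !mxE.
apply/forallP/eqP => [H|H j].
  apply: (@eq_from_nth _ 0); rewrite !size_map !size_tuple // => j jn.
  by rewrite nthE insubT /= (eqP (H _)) (tnth_nth 0).
by rewrite (tnth_nth 0) -H nthE valK.
Qed.

(** * Multisets of residual sums as numbers in base [B] *)

(** When [size s < B] no carry occurs, and the digit at position [k] is the multiplicity of [k] in
    [s]. *)
Definition code (B : nat) (s : seq nat) : nat := \sum_(k <- s) B ^ k.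

Lemma code_nil B : code B [::] = 0. Proof. exact: big_nil. Qed.

Lemma code_cons B k s : code B (k :: s) = B ^ k + code B s.
Proof. exact: big_cons. Qed.

Lemma code_rcons B s k : code B (rcons s k) = code B s + B ^ k.
Proof. by rewrite /code -cats1 big_cat big_seq1. Qed.

Lemma perm_code B s t : perm_eq s t -> code B s = code B t.
Proof. exact: perm_big. Qed.

Lemma code_lt B k s : all (fun i => i < k) s -> size s < B -> code B s < B ^ k.
Proof.
case: k => [|k] sk sB; first by case: s sk sB => //; rewrite code_nil.
apply: (@leq_ltn_trans (size s * B ^ k)); last first.
  by rewrite expnS ltn_pmul2r // expn_gt0 (leq_ltn_trans _ sB).
elim: s sk sB => [|i s IHs] /=; first by rewrite code_nil.
move=> /andP[ik sk] sB; rewrite code_cons mulSn leq_add //.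
  by rewrite leq_pexp2l // (leq_ltn_trans _ sB).
by apply: IHs => //; apply: ltnW.
Qed.

(** The elements above [k] contribute multiples of [B ^ k.+1], collected in [Q], whose value is
    irrelevant modulo [B]. *)
Lemma code_split B k s : exists Q,
  code B s = (Q * B + count_mem k s) * B ^ k + code B [seq i <- s | i < k].
Proof.
elim: s => [|i s [Q IHs]]; first by exists 0; rewrite !code_nil.
rewrite code_cons IHs /=; case: (ltngtP i k) => [ik|ki|->].
- by exists Q; rewrite code_cons; lia.
- exists (Q + B ^ (i - k.+1)).
  have -> : B ^ i = B ^ (i - k.+1) * B * B ^ k by rewrite -expnSr -expnD; congr (_ ^ _); lia.
  by lia.
- by exists Q; lia.
Qed.

Lemma code_digit B k s : size s < B -> code B s %/ B ^ k %% B = count_mem k s.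
Proof.
move=> sB; have [Q ->] := code_split B k s.
have B0 : 0 < B by apply: leq_ltn_trans sB.
rewrite divnMDl ?expn_gt0 ?B0 // divn_small ?addn0; last first.
  apply: code_lt; first exact: filter_all.
  by apply: leq_ltn_trans sB; rewrite size_filter count_size.
by rewrite modnMDl modn_small // (leq_ltn_trans (count_size _ _)).
Qed.

Lemma sum_count rho s : all (leq^~ rho) s ->
  \sum_(k < rho.+1) k * count_mem (k : nat) s = sumn s.
Proof.
elim: s => [|a s IHs] /=; first by move=> _; rewrite big1 // => k; rewrite muln0.
move=> /andP[ar sr]; rewrite -IHs //.
under eq_bigr do rewrite mulnDr.
rewrite big_split /=; congr (_ + _).
rewrite (bigD1 (Ordinal (ar : a < rho.+1))) //= eqxx muln1 big1 ?addn0 // => k.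
by rewrite -val_eqE /= eq_sym => /negPf->; rewrite muln0.
Qed.

(** * Course-of-values recursion and the dynamic program *)

Fixpoint history (step : (nat -> nat) -> nat -> nat) (n : nat) : seq nat :=
  if n is n'.+1 then
    let h := history step n' in rcons h (step (nth 0 h) n')
  else [::].

Definition course_of_values step x := nth 0 (history step x.+1) x.

Lemma size_history step n : size (history step n) = n.
Proof. by elim: n => //= n IHn; rewrite size_rcons IHn. Qed.

Lemma nth_history step n y : y < n ->
  nth 0 (history step n) y = course_of_values step y.
Proof.
elim: n => // n IHn; rewrite ltnS leq_eqVlt => /predU1P[->//|yn].
by rewrite /= nth_rcons size_history yn IHn.
Qed.

Definition causal (step : (nat -> nat) -> nat -> nat) :=
  forall h h' x, (forall y, y < x -> h y = h' y) -> step h x = step h' x.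

Lemma course_of_valuesE step x : causal step ->
  course_of_values step x = step (course_of_values step) x.
Proof.
move=> cs; rewrite {1}/course_of_values /= nth_rcons size_history ltnn eqxx.
by apply: cs => y; apply: nth_history.
Qed.

(* The state with [j] columns left after the current one, untreated rows [s]    *)
(* and treated rows [t] has the index [x = j * P^2 + P * code B s + code B t],  *)
(* where [P = B ^ rho.+1] and [q = x %% P^2].  [pick] treats a row with the     *)
(* largest residual sum, which it moves from the high to the low digits of [q]; *)
(* hence every read is at an index below [x].                                   *)
Fixpoint pick (B P : nat) (h : nat -> nat) (x q base k : nat) : nat :=
  if P * B ^ k <= q then \sum_(l < k.+1) h (x - P * B ^ k + B ^ l)
  else if k is k'.+1 then pick B P h x q base k' else base.

Definition digit_sum (B rho q : nat) := \sum_(k < rho.+1) k * (q %/ B ^ k %% B).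

(** [D j] stands for the sum of the last [j] columns. [pick] falls back on its base value when
    [q < P], that is, when the column is finished and [q] encodes the treated rows. Their total is
    then compared with [D j], and multiplying [q] by [P] declares all rows untreated for the next
    column. *)
Definition dp_step (rho B : nat) (D : nat -> nat) (h : nat -> nat) (x : nat) : nat :=
  let P := B ^ rho.+1 in
  let j := x %/ (P * P) in
  let q := x %% (P * P) in
  pick B P h x q
    ((digit_sum B rho q == D j) * (if 0 < j then h (j.-1 * (P * P) + q * P) else 1))
    rho.

(** The position [k0] depends on [q] but neither on [h] nor on [base], so the same case applies to
    two different tables, as causality requires. *)
Lemma pickP B P x q k :
  (exists k0, [/\ k0 <= k, P * B ^ k0 <= q, forall i, k0 < i <= k -> q < P * B ^ i
    & forall h base, pick B P h x q base k
        = \sum_(l < k0.+1) h (x - P * B ^ k0 + B ^ l)])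
  \/ ((forall i, i <= k -> q < P * B ^ i)
      /\ forall h base, pick B P h x q base k = base).
Proof.
elim: k => [|k IHk] /=.
  have [q0|q0] := leqP (P * B ^ 0) q; first by left; exists 0; split => // i; lia.
  by right; split=> // i; rewrite leqn0 => /eqP->.
have [qk|qk] := leqP (P * B ^ k.+1) q; first by left; exists k.+1; split => // i; lia.
case: IHk => [[k0 [k0k qk0 nk0 pE]]|[nk pE]]; [left | right].
  exists k0; split=> //; first exact: leqW.
  move=> i /andP[k0i]; rewrite leq_eqVlt => /predU1P[->//|ik].
  by apply: nk0; rewrite k0i.
by split=> // i; rewrite leq_eqVlt => /predU1P[->//|ik]; apply: nk.
Qed.

Lemma pick_read B rho x k l : 1 < B -> l <= k -> k <= rho ->
  B ^ rho.+1 * B ^ k <= x -> x - B ^ rho.+1 * B ^ k + B ^ l < x.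
Proof.
move=> B1 lk kr xk.
have : B ^ l < B ^ rho.+1 * B ^ k by rewrite -expnD ltn_exp2l //; lia.
lia.
Qed.

Lemma base_read P x : 1 < P -> x %% (P * P) < P -> 0 < x %/ (P * P) ->
  (x %/ (P * P)).-1 * (P * P) + x %% (P * P) * P < x.
Proof.
move=> P1 qP j0; rewrite {3}(divn_eq x (P * P)).
by move: qP j0; move: (x %/ _) (x %% _) => [//|j] q; rewrite /= mulSn; nia.
Qed.

Lemma dp_step_causal rho B D : 1 < B -> causal (dp_step rho B D).
Proof.
move=> B1 h h' x hh; rewrite /dp_step; set P := B ^ rho.+1.
have P1 : 1 < P by rewrite -[1](expn0 B) ltn_exp2l.
have qx : x %% (P * P) <= x by apply: leq_mod.
case: (pickP B P x (x %% (P * P)) rho) => [[k [kr qk _ pE]]|[nk pE]]; rewrite !pE.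
  apply: eq_bigr => l _; apply: hh; apply: pick_read => //; last exact: leq_trans qx.
  by rewrite -ltnS.
case: ifP => // j0; rewrite hh //; apply: base_read => //.
by have := nk 0 (leq0n _); rewrite expn0 muln1.
Qed.

(** A step adds at most [rho + 1] earlier values or copies one of them, so values grow by a factor
    of at most [rho + 1] per index and their bit length is linear in [x]. *)
Lemma dp_step_le rho B D h x : 1 < B ->
  (forall y, y < x -> h y <= rho.+1 ^ y) -> dp_step rho B D h x <= rho.+1 ^ x.
Proof.
move=> B1 hh; rewrite /dp_step; set P := B ^ rho.+1.
have P1 : 1 < P by rewrite -[1](expn0 B) ltn_exp2l.
have qx : x %% (P * P) <= x by apply: leq_mod.
case: (pickP B P x (x %% (P * P)) rho) => [[k [kr qk _ pE]]|[nk pE]]; rewrite !pE.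
  apply: (@leq_trans (\sum_(l < k.+1) rho.+1 ^ x.-1)).
    apply: leq_sum => l _.
    have rx : x - P * B ^ k + B ^ l < x.
      by apply: pick_read => //; [rewrite -ltnS | exact: leq_trans qx].
    by apply: leq_trans (hh _ rx) _; rewrite leq_pexp2l //; lia.
  rewrite sum_nat_const card_ord.
  have x0 : 0 < x.
    by apply: leq_trans qx; apply: leq_trans qk; rewrite muln_gt0 !expn_gt0; lia.
  by rewrite -[in X in _ <= X](prednK x0) expnS leq_mul2r orbC ltnS kr.
apply: (@leq_trans (1 * (rho.+1 ^ x))); last by rewrite mul1n.
apply: leq_mul; first by case: (_ == _).
case: ifP => [j0|_]; last by rewrite expn_gt0.
apply: (@leq_trans (rho.+1 ^ ((x %/ (P * P)).-1 * (P * P) + x %% (P * P) * P))).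
  apply: hh; apply: base_read => //.
  by have := nk 0 (leq0n _); rewrite expn0 muln1.
rewrite leq_pexp2l // ltnW //; apply: base_read => //.
by have := nk 0 (leq0n _); rewrite expn0 muln1.
Qed.

Definition dp rho B D := course_of_values (dp_step rho B D).

Lemma dp_le rho B D x : 1 < B -> dp rho B D x <= rho.+1 ^ x.
Proof.
move=> B1; elim/ltn_ind: x => x IHx; rewrite /dp course_of_valuesE //.
  exact: dp_step_le.
exact: dp_step_causal.
Qed.

Lemma max_mem (s : seq nat) : s != [::] ->
  exists2 k, k \in s & all (leq^~ k) s.
Proof.
elim: s => // a [|b s] IHs _; first by exists a; rewrite ?mem_head //= leqnn.
have [k ks /allP sk] := IHs isT.
have [ak|ka] := leqP a k.
  exists k; first by rewrite inE ks orbT.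
  by rewrite /= ak; apply/(allP (s := b :: s)).
exists a; first exact: mem_head.
by rewrite /= leqnn; apply/(allP (s := b :: s)) => i /sk ik; apply: leq_trans ik (ltnW ka).
Qed.

(** Induction on [j], and inside it on the number of untreated rows. [pick] treats a largest
    untreated row whereas [split_column] treats the first one; symmetry reconciles the two
    orders. *)
Lemma dpE rho B c j s t (P := B ^ rho.+1) :
  1 < B -> j <= size c ->
  all (leq^~ rho) s -> all (leq^~ rho) t -> size s + size t < B ->
  dp rho B (fun i => sumn (drop (size c - i) c)) (j * (P * P) + (P * code B s + code B t))
  = split_column (count_tables (drop (size c - j) c)) s t.
Proof.
move=> B1; set D := (fun i => sumn _); set n := size c.
have P0 : 0 < P by rewrite expn_gt0; lia.
have P1 : 1 < P by rewrite -[1](expn0 B) ltn_exp2l.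
elim/ltn_ind: j s t => j IHj s t jn.
have [N] := ubnP (size s); elim: N s t => // N IHN s t /ltnSE sN sr tr stB.
have cs : code B s < P by apply: code_lt => //; lia.
have ct : code B t < P by apply: code_lt => //; lia.
have qH : P * code B s + code B t < P * P by nia.
set q := P * code B s + code B t in qH *; set x := j * (P * P) + q.
rewrite /dp course_of_valuesE; last exact: dp_step_causal.
rewrite -/(dp rho B D) /dp_step -/P.
have xd : x %/ (P * P) = j.
  by rewrite /x divnMDl ?muln_gt0 ?P0 // divn_small // addn0.
have xm : x %% (P * P) = q by rewrite /x modnMDl modn_small.
rewrite xd xm; case: (pickP B P x q rho) => [[k [kr qk nk ->]]|[nk ->]].
  have [s0|s0] := eqVneq s [::].
    by move: qk; rewrite /q s0 code_nil; have : 0 < B ^ k; [rewrite expn_gt0 (ltnW B1) | nia].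
  have [i si smax] := max_mem s0.
  (* The leading digit of [code B s] sits at the maximum of [s], and [code B t < P] is too small to
     affect the comparison of [q] with [P * B ^ k]. *)
  have ki : k = i.
    have ir : i <= rho by apply: (allP sr).
    apply/eqP; rewrite eqn_leq; apply/andP; split; last first.
      rewrite leqNgt; apply/negP => ki; have := nk i; rewrite ki ir => /(_ isT).
      by rewrite /q (perm_code B (perm_to_rem si)) code_cons; nia.
    rewrite leqNgt; apply/negP => ik.
    have : code B s < B ^ k by apply: code_lt; [apply: sub_all smax => a; lia | lia].
    by move: qk; rewrite /q; nia.
  subst k; rewrite (@split_column_perm _ s (i :: rem i s) t t) //; last first.
  - exact: perm_to_rem.
  - exact: count_tables_perm.
  rewrite [RHS]/=; apply: eq_bigr => l _.
  have sE : code B s = B ^ i + code B (rem i s).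
    by rewrite -code_cons; apply/perm_code/perm_to_rem.
  have szE : size (rem i s) = (size s).-1 by apply: size_rem.
  have sz0 : 0 < size s by case: (s) s0.
  rewrite -IHN //; first (congr (dp _ _ _ _)).
  - by rewrite code_rcons /x /q sE; nia.
  - by rewrite szE; lia.
  - by apply/allP => a /mem_rem /(allP sr).
  - by rewrite all_rcons tr andbT; have := ltn_ord l; lia.
  - by rewrite size_rcons szE; lia.
have s0 : s = [::].
  have [//|s0] := eqVneq s [::]; have [k ks _] := max_mem s0.
  have := nk k (allP sr _ ks).
  by rewrite /q (perm_code B (perm_to_rem ks)) code_cons; nia.
subst s; rewrite /q code_nil muln0 add0n /digit_sum.
under eq_bigr do rewrite code_digit //.
rewrite sum_count // {1}/D -/n.
clear x xd xm IHN; case: j IHj jn => [|j] IHj jn /=; first by rewrite subn0 drop_size muln1.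
rewrite (drop_nth 0) /=; last by rewrite -/n; lia.
have -> : (n - j.+1).+1 = n - j by lia.
congr (_ * _).
rewrite -(IHj j (ltnSn j) t [::]) ?addn0 ?(ltnW jn) //.
by rewrite code_nil addn0 (mulnC P).
Qed.

(** * The program, its correctness and its cost *)

(** Expressions have no conditional, so [b] must evaluate to 0 or 1. Both branches are evaluated and
    paid for; the rejected one is multiplied by 0. *)
Definition eif (b e1 e2 : expr) : expr :=
  Binop Add (Binop Mul b e1) (Binop Mul (Binop Defs.Sub (Const 1) b) e2).

Definition eeq (e1 e2 : expr) : expr := Binop Mul (Binop Leq e1 e2) (Binop Leq e2 e1).

Fixpoint esum (n : nat) (e : nat -> expr) : expr :=
  if n is n'.+1 then Binop Add (esum n' e) (e n') else Const 0.

Definition epow (e : expr) (k : nat) : expr := iter k (Binop Mul e) (Const 1).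

Lemma eval_eif s (b : bool) e e1 e2 : eval e s = b ->
  eval (eif e e1 e2) s = if b then eval e1 s else eval e2 s.
Proof. by move=> /= ->; case: b; rewrite /= mul1n ?addn0. Qed.

Lemma eval_eeq s e1 e2 : eval (eeq e1 e2) s = (eval e1 s == eval e2 s).
Proof. by rewrite /= mulnb eqn_leq. Qed.

Lemma eval_esum s n e : eval (esum n e) s = \sum_(k < n) eval (e k) s.
Proof. by elim: n => [|n IHn] /=; rewrite ?big_ord0 // big_ord_recr /= IHn. Qed.

Lemma eval_epow s e k : eval (epow e k) s = eval e s ^ k.
Proof. by elim: k => //= k ->; rewrite expnS. Qed.

(* Arrays 4, 6 and 8 hold loop counters, array 5 the sums of the last columns,  *)
(* array 7 the codes of the prefixes of the row sums, array 9 the values of     *)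
(* [dp].                                                                        *)
Definition base : expr := Binop Add (var 0) (Const 1).

Definition esuffix : expr :=
  eif (Binop Leq (Const 1) (var 4))
    (Binop Add (Cell 5 (Binop Defs.Sub (var 4) (Const 1)))
               (Cell 3 (Binop Defs.Sub (var 1) (var 4))))
    (Const 0).

(** [epow] only takes constant exponents; the power with exponent a row sum is therefore selected
    among all [k <= rho] by equality tests. *)
Definition ecode (rho : nat) : expr :=
  eif (Binop Leq (Const 1) (var 6))
    (Binop Add (Cell 7 (Binop Defs.Sub (var 6) (Const 1)))
       (esum rho.+1 (fun k =>
          Binop Mul (eeq (Const k) (Cell 2 (Binop Defs.Sub (var 6) (Const 1))))
                    (epow base k))))
    (Const 0).

Definition eshift (rho : nat) : expr := epow base rho.+1.

Definition esquare (rho : nat) : expr := Binop Mul (eshift rho) (eshift rho).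

Definition ecolumn (rho : nat) : expr := Binop Div (var 8) (esquare rho).

Definition estate (rho : nat) : expr := Binop Mod (var 8) (esquare rho).

Definition ebase (rho : nat) : expr :=
  Binop Mul
    (eeq (esum rho.+1 (fun k => Binop Mul (Const k)
            (Binop Mod (Binop Div (estate rho) (epow base k)) base)))
         (Cell 5 (ecolumn rho)))
    (eif (Binop Leq (Const 1) (ecolumn rho))
       (Cell 9 (Binop Add
          (Binop Mul (Binop Defs.Sub (ecolumn rho) (Const 1)) (esquare rho))
          (Binop Mul (estate rho) (eshift rho))))
       (Const 1)).

Fixpoint epick (rho k : nat) : expr :=
  let top := Binop Mul (eshift rho) (epow base k) in
  eif (Binop Leq top (estate rho))
    (esum k.+1 (fun l => Cell 9 (Binop Add (Binop Defs.Sub (var 8) top) (epow base l))))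
    (if k is k'.+1 then epick rho k' else ebase rho).

(** The answer is read at a state where a fictitious column has just been finished: [n] columns are
    left, and all rows are treated with their full sums. Hence [j] ranges over [n + 1] values. *)
Definition prog (rho : nat) : cmd :=
  Seq (tabulate 4 5 (Binop Add (var 1) (Const 1)) esuffix)
  (Seq (tabulate 6 7 base (ecode rho))
  (Seq (tabulate 8 9 (Binop Mul (Binop Add (var 1) (Const 1)) (esquare rho))
          (epick rho rho))
  (Seq (Assign 0 (Const 0)
          (Cell 9 (Binop Add (Binop Mul (var 1) (esquare rho)) (Cell 7 (var 0)))))
       (Assign 1 (Const 0) (Const 1))))).

Lemma eval_op o e1 e2 s :
  eval (Binop o e1 e2) s = eval_binop o (eval e1 s) (eval e2 s).
Proof. by []. Qed.

Lemma eval_cell a e s : eval (Cell a e) s = s a (eval e s).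
Proof. by []. Qed.

Lemma eval_base s : eval base s = (s 0 0).+1.
Proof. by rewrite /= addn1. Qed.

Lemma eval_eshift rho s : eval (eshift rho) s = (s 0 0).+1 ^ rho.+1.
Proof. by rewrite eval_epow eval_base. Qed.

Lemma eval_esquare rho s :
  eval (esquare rho) s = (s 0 0).+1 ^ rho.+1 * (s 0 0).+1 ^ rho.+1.
Proof. by rewrite eval_op !eval_eshift. Qed.

Lemma eval_epick rho s :
  eval (epick rho rho) s = dp_step rho (s 0 0).+1 (s 5) (s 9) (s 8 0).
Proof.
rewrite /dp_step; set B := (s 0 0).+1; set P := B ^ rho.+1; set x := s 8 0.
have ej : eval (ecolumn rho) s = x %/ (P * P) by rewrite eval_op eval_esquare.
have eq : eval (estate rho) s = x %% (P * P) by rewrite eval_op eval_esquare.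
have eb : eval (ebase rho) s
    = (digit_sum B rho (x %% (P * P)) == s 5 (x %/ (P * P)))
      * (if 0 < x %/ (P * P)
         then s 9 ((x %/ (P * P)).-1 * (P * P) + x %% (P * P) * P) else 1).
  rewrite /ebase; have ebE := eval_base s; rewrite -/B in ebE.
  have eP := eval_eshift rho s; have eH := eval_esquare rho s.
  (* Only the values of these subexpressions matter; abstracting them keeps [eval] from unfolding
     them. *)
  move: base (ecolumn rho) (estate rho) (eshift rho) (esquare rho) ebE ej eq eP eH.
  move=> eB ec es eP eQ ebE ej eq ePE eQE.
  rewrite eval_op eval_eeq eval_cell ej eval_esum.
  rewrite (@eval_eif _ (0 < x %/ (P * P))); last by rewrite eval_op ej.
  rewrite eval_cell !eval_op ej eq ePE eQE [eval (Const 1) s]/= [eval_binop _ _ 1]/= subn1.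
  congr ((_ == _) * _); apply: eq_bigr => k _.
  by rewrite !eval_op eq eval_epow ebE.
have etop k : eval (Binop Leq (Binop Mul (eshift rho) (epow base k)) (estate rho)) s
    = (P * B ^ k <= x %% (P * P)).
  by rewrite (eval_op Leq) (eval_op Mul (eshift rho)) eq eval_eshift eval_epow eval_base.
have esumE k : eval (esum k.+1 (fun l => Cell 9 (Binop Add (Binop Defs.Sub (var 8)
    (Binop Mul (eshift rho) (epow base k))) (epow base l)))) s
    = \sum_(l < k.+1) s 9 (x - P * B ^ k + B ^ l).
  rewrite eval_esum; apply: eq_bigr => l _.
  by rewrite eval_cell (eval_op Add) (eval_op Defs.Sub)
    (eval_op Mul (eshift rho)) eval_eshift !eval_epow eval_base.
elim: {2 4}rho => [|k IHk].
  by rewrite [LHS](eval_eif _ _ (etop 0)) esumE eb.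
by rewrite [LHS](eval_eif _ _ (etop k.+1)) esumE IHk.
Qed.

Lemma dp_step_ext rho B D D' h h' x : 1 < B ->
  D (x %/ (B ^ rho.+1 * B ^ rho.+1)) = D' (x %/ (B ^ rho.+1 * B ^ rho.+1)) ->
  (forall y, y < x -> h y = h' y) -> dp_step rho B D h x = dp_step rho B D' h' x.
Proof.
by move=> B1 DE /(dp_step_causal rho D B1)->; rewrite /dp_step DE.
Qed.

Lemma le_pow2 x y : x <= y -> x <= 2 ^ y.
Proof. by move=> xy; apply: leq_trans xy _; apply/ltnW/ltn_expl. Qed.

Definition prog_cost (rho : nat) : nat :=
  tabulate_cost (Binop Add (var 1) (Const 1)) esuffix
  + tabulate_cost base (ecode rho)
  + tabulate_cost (Binop Mul (Binop Add (var 1) (Const 1)) (esquare rho)) (epick rho rho)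
  + 3 * (1 + weight (Cell 9 (Binop Add (Binop Mul (var 1) (esquare rho)) (Cell 7 (var 0))))) ^ 2
  + 31.

(** [W] is [rho + 1] times the number [U] of states: since [(rho + 1) ^ x <= 2 ^ ((rho + 1) * x)],
    every stored number is at most [2 ^ W]. Each loop has at most [W] rounds, each of cost quadratic
    in [W + 1], whence the cube. *)
Lemma exec_prog rho m n (r : m.-tuple nat) (c : n.-tuple nat)
    (W := rho.+1 * (n.+1 * (m.+1 ^ rho.+1 * m.+1 ^ rho.+1))) :
  0 < m -> all (leq^~ rho) r -> sumn c <= rho * m ->
  exists t s, [/\ exec (prog rho) (input r c) t s, t <= prog_cost rho * W.+1 ^ 3,
    s 0 0 = count_tables c r & s 1 0 = 1].
Proof.
move=> m0 rr cm; set B := m.+1 in W *.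
have B1 : 1 < B by [].
set P := B ^ rho.+1 in W *.
have PB : B <= P by rewrite -[X in X <= _]expn1 leq_exp2l.
have P0 : 0 < P by apply: leq_trans PB.
pose U := n.+1 * (P * P).
have WE : W = rho.+1 * U by [].
have UW : U <= W by rewrite WE mulSn leq_addr.
have PU : P <= U by rewrite /U; nia.
have W0 : 0 < W by lia.
have nU : n.+1 <= U by rewrite /U; nia.
have cW : sumn c <= W.
  apply: leq_trans cm _; rewrite WE mulSn; apply: leq_trans (leq_addl _ _).
  by rewrite leq_mul2l; apply/orP; right; lia.
have rB : size r < B by rewrite size_tuple.
pose D j := sumn (drop (n - j) c).
pose Y i := code B (take i r).
pose F := dp rho B D.
have DW j : D j <= W.
  by apply: leq_trans cW; rewrite -[X in _ <= sumn X](cat_take_drop (n - j) c) sumn_cat leq_addl.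
have YP i : Y i < P.
  apply: code_lt; last by apply: leq_ltn_trans rB; rewrite size_take_min geq_minr.
  by apply/allP => a /mem_take /(allP rr).
have FW x : x < U -> F x <= 2 ^ W.
  move=> xU; apply: leq_trans (dp_le _ _ _ B1) _.
  apply: (@leq_trans ((2 ^ rho.+1) ^ x)).
    by case: x xU => // x _; rewrite leq_exp2r // ltnW // ltn_expl.
  by rewrite -expnM leq_exp2l // WE leq_mul2l ltnW ?orbT.
have DS i : 0 < i <= n -> D i = D i.-1 + nth 0 c (n - i).
  case: i => // i; rewrite /= /D => ilt.
  rewrite (drop_nth 0 (s := c)) /= ?size_tuple; last lia.
  by rewrite addnC; congr (sumn (drop _ _) + _); lia.
have YS i : 0 < i <= m -> Y i = Y i.-1 + B ^ nth 0 r i.-1.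
  case: i => // i /= im; rewrite /Y (take_nth 0) ?size_tuple // code_rcons //.
set s0 := input r c.
pose s1 := tabulated s0 4 5 D n.+1.
pose s2 := tabulated s1 6 7 Y m.+1.
pose s3 := tabulated s2 8 9 F U.
have b0 : bounded (2 ^ W) s0.
  have n0 k (t : seq nat) i : k <= 2 ^ W -> all (leq^~ k) t -> nth 0 t i <= 2 ^ W.
    move=> kW /allP tk; have [it|it] := ltnP i (size t); last by rewrite nth_default.
    by apply: leq_trans kW; apply/tk/mem_nth.
  move=> [|[|[|[|a]]]] i //=.
  - by case: (i == 0) => //; apply: le_pow2; lia.
  - by case: (i == 0) => //; apply: le_pow2; lia.
  - by apply: (@n0 rho) => //; apply: le_pow2; rewrite WE; nia.
  apply: (@n0 (sumn c)); first exact: le_pow2.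
  apply/allP => a ac; rewrite sumnE (big_rem a) //= leq_addr //.
have UW2 : U <= 2 ^ W by apply: le_pow2.
have nW2 : n.+1 <= 2 ^ W by apply: le_pow2; lia.
have mW2 : m.+1 <= 2 ^ W by apply: le_pow2; rewrite -/B; lia.
have DW2 i : D i <= 2 ^ W by apply: le_pow2.
have YW2 i : Y i <= 2 ^ W by apply: le_pow2; have := YP i; lia.
have b1 : bounded (2 ^ W) s1 by apply: bounded_tabulated.
have b2 : bounded (2 ^ W) s2 by apply: bounded_tabulated.
have b3 : bounded (2 ^ W) s3 by apply: bounded_tabulated.
have [||t1 x1 t1le] := @exec_tabulate W s0 4 5 (Binop Add (var 1) (Const 1)) esuffix
    D n.+1 W0 isT erefl b0 nW2 (fun i _ => DW2 i).
- by move=> i _; rewrite /= /tabulated /= addn1.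
- move=> i ilt; rewrite /esuffix (@eval_eif _ (0 < i)) //.
  case: i ilt => [|i] ilt; first by rewrite /D subn0 drop_oversize // size_tuple.
  by rewrite DS //= /tabulated /= subn1 ltnSn.
have [||t2 x2 t2le] := @exec_tabulate W s1 6 7 base (ecode rho)
    Y m.+1 W0 isT erefl b1 mW2 (fun i _ => YW2 i).
- by move=> i _; rewrite eval_base.
- move=> i ilt; rewrite /ecode (@eval_eif _ (0 < i)) //.
  case: i ilt => [|i] ilt; first by rewrite /Y take0 code_nil.
  rewrite YS // (eval_op Add) eval_esum; congr (_ + _).
    by rewrite /= /tabulated /= subn1 ltnSn.
  have rk : nth 0 r i < rho.+1 by rewrite ltnS; apply/(allP rr)/mem_nth; rewrite size_tuple.
  under eq_bigr => k _.
    rewrite (eval_op Mul) eval_eeq eval_epow eval_base /= /tabulated /= subn1 /=.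
    over.
  rewrite (bigD1 (Ordinal rk)) //= eqxx mul1n big1 ?addn0 // => k.
  by rewrite -val_eqE /= => /negPf->.
have [||t3 x3 t3le] := @exec_tabulate W s2 8 9
    (Binop Mul (Binop Add (var 1) (Const 1)) (esquare rho)) (epick rho rho)
    F U W0 isT erefl b2 UW2 FW.
- by move=> i _; rewrite (eval_op Mul) eval_esquare /= /tabulated /= addn1.
(* In round [i] array 9 holds [dp] only below [i], and array 5 holds [D] only up to [n]; causality
   and [i < U] ensure that nothing else is needed. *)
- move=> i iU; rewrite eval_epick {1 4}/tabulated /= /F /dp course_of_valuesE.
    apply: dp_step_ext => // [|y yi]; last by rewrite /tabulated /= yi.
    rewrite /tabulated /= /s2 /s1 /tabulated /= ltnS.
    have -> // : i %/ (P * P) <= n.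
    by rewrite -ltnS ltn_divLR // muln_gt0 P0.
  exact: dp_step_causal.
have vE : s3 9 (n * (P * P) + Y m) = count_tables c r.
  rewrite /s3 /tabulated /= ifT; last by rewrite /U mulSn; have := YP m; nia.
  have := @dpE rho B c n [::] r B1; rewrite code_nil muln0 add0n.
  rewrite /Y take_oversize ?size_tuple //= subnn drop0; apply => //.
set e := Cell 9 (Binop Add (Binop Mul (var 1) (esquare rho)) (Cell 7 (var 0))).
have eE : eval e s3 = count_tables c r.
  rewrite -vE /e eval_cell (eval_op Add) (eval_op Mul) eval_esquare.
  have s37 : s3 7 m = Y m by rewrite /s3 /s2 /tabulated /= ltnSn.
  by rewrite -s37.
pose s4 := update s3 0 0 (count_tables c r).
have [|t4 x4 t4le] := exec_assign (s' := s4) (a := 0) (e1 := Const 0) (e2 := e) W0 b3.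
  by rewrite eE.
have b4 : bounded (2 ^ W) s4.
  move=> a i; rewrite /s4 /update; case: ifP => // _; rewrite -vE; exact: b3.
have [|t5 x5 t5le] := exec_assign (s' := update s4 1 0 1) (a := 1) (e1 := Const 0)
  (e2 := Const 1) W0 b4; first by [].
exists (t1 + (t2 + (t3 + (t4 + t5).+1).+1).+1).+1, (update s4 1 0 1); split=> //.
  exact: ExecSeq x1 (ExecSeq x2 (ExecSeq x3 (ExecSeq x4 x5))).
have cube T t u : u <= W -> t <= T * W.+1 ^ 2 * u.+1 -> t <= T * W.+1 ^ 3.
  move=> uW /leq_trans; apply.
  by rewrite (expnSr _ 2) mulnA leq_mul2l ltnS uW orbT.
have square T t : t <= T * W.+1 ^ 2 -> t <= T * W.+1 ^ 3.
  by move=> /leq_trans; apply; rewrite leq_mul2l leq_exp2l // orbT.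
have := cube _ _ _ (leq_trans nU UW) t1le.
have := cube _ _ _ (leq_trans PB (leq_trans PU UW)) t2le.
have := cube _ _ _ UW t3le; have := square _ _ t4le; have := square _ _ t5le.
have : 0 < W.+1 ^ 3 by rewrite expn_gt0.
rewrite /prog_cost -/e [weight (Const 0)]/= [weight (Const 1)]/=.
move: (tabulate_cost _ _) (tabulate_cost _ _) (tabulate_cost _ _) => a1 a2 a3.
rewrite (_ : 3 * (1 + 2) ^ 2 = 27) //.
move: (3 * (1 + weight e) ^ 2) (W.+1 ^ 3) => a4 L3; lia.
Qed.

(** * Polynomial bound in [m] and conclusion *)

(** Constants are absorbed by [x <= m.+1 ^ x]: [prog_cost rho] gives the first summand, and [W + 1
    <= 2 * rho.+1 ^ 2 * m.+1 ^ (2 * rho + 3)], cubed, gives the second. *)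
Definition prog_degree (rho : nat) : nat :=
  prog_cost rho + 3 * (2 * rho.+1 ^ 2 + (2 * rho + 3)).

Lemma prog_cost_poly rho m n : 0 < m -> n <= rho * m ->
  prog_cost rho * (rho.+1 * (n.+1 * (m.+1 ^ rho.+1 * m.+1 ^ rho.+1))).+1 ^ 3
  <= m.+1 ^ prog_degree rho.
Proof.
move=> m0 nm; rewrite /prog_degree.
have powB x : x <= m.+1 ^ x by apply/ltnW/ltn_expl.
rewrite expnD; apply: leq_mul => //; rewrite (mulnC 3) expnM leq_exp2r // expnD.
set H := _ * (m.+1 ^ _); have HE : m.+1 ^ (2 * rho + 3) = m.+1 * H.
  by rewrite /H -expnD -expnS; congr (_ ^ _); lia.
apply: leq_trans (leq_mul (powB _) (leqnn _)); rewrite HE.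
have H0 : 0 < H by rewrite muln_gt0 !expn_gt0.
have nB : n.+1 <= rho.+1 * m.+1 by lia.
apply: (@leq_trans (2 * (rho.+1 * (n.+1 * H)))); first nia.
have := leq_mul (leq_mul (leqnn (2 * rho.+1)) nB) (leqnn H).
by rewrite -mulnn; lia.
Qed.

Local Open Scope ring_scope.

Theorem mainTheorem5 (R : realType) (eps : R) (rho : nat)
    (eps_gt0 : 0 < eps) (eps_lt1 : eps < 1) (rho_gt0 : (0 < rho)%N) :
  exists (p : cmd) (K : R),
    forall (m n N : nat) (r : m.-tuple nat) (c : n.-tuple nat),
      (0 < m)%N -> (0 < n)%N ->
      (forall i : 'I_m, (0 < tnth r i <= rho)%N) ->
      (forall j : 'I_n, (0 < tnth c j)%N) ->
      (\sum_(i < m) tnth r i)%N = N ->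
      (\sum_(j < n) tnth c j)%N = N ->
      exists (t : nat) (s : store),
        [/\ exec p (input r c) t s,
            t%:R <= quasi_poly_bound K m n
          & approx_within ((1 - eps) ^+ N) (num_tables r c)%:R (output R s)].
Proof.
(* Dividing by [ln 2] makes [K * ln (n + 1)] at least the degree for every [n >= 1]. *)
exists (prog rho), ((prog_degree rho)%:R / ln 2) => m n N r c m0 n0 rr cc rN cN.
have rle : all (leq^~ rho) r by apply/all_tnthP => i; case/andP: (rr i).
have cm : (sumn c <= rho * m)%N.
  have -> : sumn c = (\sum_(i < m) tnth r i)%N by rewrite rN -cN sumnE big_tuple.
  apply: (@leq_trans (\sum_(i < m) rho)%N); last by rewrite sum_nat_const card_ord mulnC.
  by apply: leq_sum => i _; case/andP: (rr i).
(* Each column sum is at least 1, so there are at most [N] columns. *)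
have nm : (n <= rho * m)%N.
  apply: leq_trans cm; rewrite sumnE big_tuple -[X in (X <= _)%N]card_ord -sum1_card.
  exact: leq_sum.
have [t [s [ps tle s0 s1]]] := exec_prog m0 rle cm.
have tE := leq_trans tle (prog_cost_poly m0 nm).
exists t, s; split=> //.
  have ln2 : 0 < ln 2 :> R by rewrite ln_gt0 // ltr1n.
  apply: (@le_trans _ _ (m.+1%:R ^+ prog_degree rho)).
    by rewrite -natrX ler_nat.
  rewrite -powR_mulrn // ler_powR ?ler1n // -mulrA ler_peMr // ler_pdivlMl //.
  by rewrite mulr1 ler_ln ?posrE // ler_nat.
rewrite /output s0 s1 divr1 num_tablesE /approx_within lexx andbT.
by rewrite ler_piMl // exprn_ile1 // ?subr_ge0 ?gerBl ltW.
Qed.
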